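(* Let $F:\mathbb{R}^{L_q\times d_h}\to\mathbb{R}$ be continuously differentiable, let $O^{\mathrm{vis}},O^{\mathrm{txt}}\in\mathbb{R}^{L_q\times d_h}$ be fixed matrices, and for real gates $(g_{\mathrm{vis}},g_{\mathrm{txt}})$ set $$\tilde O(g_{\mathrm{vis}},g_{\mathrm{txt}})=g_{\mathrm{vis}}O^{\mathrm{vis}}+g_{\mathrm{txt}}O^{\mathrm{txt}},\qquad \ell(g_{\mathrm{vis}},g_{\mathrm{txt}})=F\big(\tilde O(g_{\mathrm{vis}},g_{\mathrm{txt}})\big),\qquad G(g_{\mathrm{vis}},g_{\mathrm{txt}})=\nabla F\big(\tilde O(g_{\mathrm{vis}},g_{\mathrm{txt}})\big).$$ Define the estimators $$\widehat\Delta^{\mathrm{vis}}=\big\langle G(1,1),O^{\mathrm{vis}}\big\rangle,\qquad \widehat\Delta^{\mathrm{txt}}=\big\langle G(1,1),O^{\mathrm{txt}}\big\rangle,$$ and the exact do-differences $\Delta^{\mathrm{vis}}=\ell(1,1)-\ell(0,1)$ and $\Delta^{\mathrm{txt}}=\ell(1,1)-\ell(1,0)$. Then $\widehat\Delta^{\mathrm{vis}}$ and $\widehat\Delta^{\mathrm{txt}}$ coincide with the first-order (Taylor) terms at $(1,1)$ of $\Delta^{\mathrm{vis}}$ and $\Delta^{\mathrm{txt}}$, i.e. $$\widehat\Delta^{\mathrm{vis}}=\frac{\partial\ell}{\partial g_{\mathrm{vis}}}(1,1),\qquad \widehat\Delta^{\mathrm{txt}}=\frac{\partial\ell}{\partial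 g_{\mathrm{txt}}}(1,1),$$ and the exact do-differences admit the path-integral form $$\Delta^{\mathrm{vis}}=\int_0^1\frac{\partial\ell}{\partial g_{\mathrm{vis}}}(\tau,1)\,d\tau,\qquad \Delta^{\mathrm{txt}}=\int_0^1\frac{\partial\ell}{\partial g_{\mathrm{txt}}}(1,\tau)\,d\tau.$$
   Context: Here $\langle A,B\rangle=\sum_{a,b}A_{ab}B_{ab}$ is the Frobenius inner product, and $\nabla F$ is the gradient with respect to it. Interpretation: fix one attention head $(l,h)$ of a transformer decoder. Its output splits exactly as $O^{\mathrm{vis}}+O^{\mathrm{txt}}$ (contributions of the value vectors of visual and of textual tokens, computed once in the unmodified model and kept fixed). $F$ maps the output of this head to a scalar decision score, everything else in the network being held fixed, and $\ell(g_{\mathrm{vis}},g_{\mathrm{txt}})$ is the score when the two routes are scaled by the gates; $(1,1)$ is the unmodified model. *)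

(* Defs.v *)
From HB Require Import structures.
From mathcomp Require Import all_boot all_order all_algebra.
From mathcomp Require Import all_classical all_reals all_analysis.

Set Implicit Arguments.
Unset Strict Implicit.
Unset Printing Implicit Defensive.

Import Order.TTheory GRing.Theory Num.Theory.
Import numFieldNormedType.Exports.

Local Open Scope classical_set_scope.
Local Open Scope ring_scope.

Definition frobenius (R : realType) (m n : nat) (A B : 'M[R]_(m, n)) : R :=
  \sum_(a < m) \sum_(b < n) A a b * B a b.

(* Riesz representative of the differential for the Frobenius inner product.
   It always exists ['d F X is linear by construction], so the default 0 is
   never used; it is meaningful where F is differentiable. *)
Definition gradient (R : realType) (m n : nat) (F : 'M[R]_(m, n) -> R)
    (X : 'M[R]_(m, n)) : 'M[R]_(m, n) :=
  xget 0 [set A | forall H, 'd F X H = frobenius A H].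

Lemma gradientP (R : realType) (m n : nat) (F : 'M[R]_(m, n) -> R)
    (X H : 'M[R]_(m, n)) :
  'd F X H = frobenius (gradient F X) H.
Proof.
rewrite /gradient; case: xgetP => [A _ -> //|noA]; exfalso.
apply: (noA (\matrix_(a, b) 'd F X (delta_mx a b))) => K /=.
rewrite {1}(matrix_sum_delta K) linear_sum; apply: eq_bigr => a _.
rewrite linear_sum; apply: eq_bigr => b _.
by rewrite linearZ mxE mulrC.
Qed.

(* The Frobenius norm of a difference of gradients is the dual norm of the
   difference of the differentials, so this is continuity of X |-> 'd F X. *)
Definition continuously_differentiable (R : realType) (m n : nat)
    (F : 'M[R]_(m, n) -> R) : Prop :=
  (forall X, differentiable F X) /\ continuous (gradient F).

Definition partial1 (R : realType) (f : R -> R -> R) (x y : R) : R :=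
  derive1 (fun t : R => f t y) x.

Definition partial2 (R : realType) (f : R -> R -> R) (x y : R) : R :=
  derive1 (fun t : R => f x t) y.

(* Main.v *)
(** Freezing one gate turns [l] into [s |-> F (s *: A + B)], the restriction of
    [F] to a line, which is C^1 with derivative [<grad F, A>] by the chain rule;
    the integral formulas are the fundamental theorem of calculus on [0, 1]. *)
Require Import Defs.
From HB Require Import structures.
From mathcomp Require Import all_boot all_order all_algebra.
From mathcomp Require Import all_classical all_reals all_analysis.

Set Implicit Arguments.
Unset Strict Implicit.
Unset Printing Implicit Defensive.

Import Order.TTheory GRing.Theory Num.Theory.
Import numFieldNormedType.Exports.

Local Open Scope classical_set_scope.
Local Open Scope ring_scope.

Section line_restriction.
Variables (R : realType) (m n : nat) (F : 'M[R]_(m, n) -> R).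
Hypothesis F_C1 : continuously_differentiable F.
Variables A B : 'M[R]_(m, n).
Let mu := @lebesgue_measure R.

Lemma is_derive_line (t : R) :
  is_derive t (1 : R) (fun s : R => F (s *: A + B))
    (frobenius (gradient F (t *: A + B)) A).
Proof.
have dF : differentiable F (t *: A + B) by case: F_C1.
(* Moving the parameter from [t] to [h + t] moves the point by [h *: A], so the difference quotient
   of the restriction is that of [F] at [t *: A + B] in direction [A]. The derivative is thus a
   directional derivative of [F], which the differential computes. *)
have quotientE : (fun h : R => h^-1 *: (F ((h *: 1 + t) *: A + B) - F (t *: A + B)))
    = (fun h : R => h^-1 *: (F (h *: A + (t *: A + B)) - F (t *: A + B))).
  by apply/funext => h; rewrite [h *: 1]mulr1 scalerDl addrA.
apply: DeriveDef.
  by rewrite /derivable quotientE; exact: diff_derivable.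
by rewrite /derive quotientE -gradientP -deriveE.
Qed.

Lemma derive1_line :
  derive1 (fun s : R => F (s *: A + B)) =
  (fun t : R => frobenius (gradient F (t *: A + B)) A).
Proof.
apply/funext => t; rewrite derive1E.
by have dF := is_derive_line t; exact: derive_val.
Qed.

(** Pairing with the fixed [A] is a finite sum of gradient entries times constants, so it suffices
    to compose [gradient F] with the affine path entry by entry; here the continuity half of [F_C1]
    enters. *)
Lemma continuous_derive1_line :
  continuous (derive1 (fun s : R => F (s *: A + B)) : R -> R).
Proof.
rewrite derive1_line /frobenius.
apply: continuous_big => [|i _]; first by apply: add_continuous.
apply: continuous_big => [|j _ t]; first by apply: add_continuous.
apply: cvgM; last exact: cvg_cst.
apply: (@continuous_comp _ _ _ (fun s : R => gradient F (s *: A + B))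
  (fun M : 'M[R]_(m, n) => M i j)); last exact: coord_continuous.
apply: (@continuous_comp _ _ _ (fun s : R => s *: A + B)); last by case: F_C1 => _; apply.
by apply: cvgD; [apply: scalel_continuous | apply: cvg_cst].
Qed.

(** [Rintegral] is total, so integrability has to be recorded separately for the path integrals to
    be meaningful. *)
Lemma integrable_derive1_line (a b : R) :
  mu.-integrable `[a, b] (EFin \o derive1 (fun s : R => F (s *: A + B))).
Proof.
apply: continuous_compact_integrable; first exact: segment_compact.
exact/continuous_subspaceT/continuous_derive1_line.
Qed.

Lemma Rintegral_derive1_line (a b : R) : a < b ->
  \int[mu]_(t in `[a, b]) derive1 (fun s : R => F (s *: A + B)) t =
  F (b *: A + B) - F (a *: A + B).
Proof.
move=> ab; pose f (s : R) := F (s *: A + B).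
have f_derivable t : derivable f t 1 by have [] := is_derive_line t.
have f_continuous : continuous f.
  by move=> t; apply/differentiable_continuous/derivable1_diffP.
(* The remaining conditions, continuity of the derivative on the segment and one-sided limits of [f]
   at its ends, follow from continuity on the whole line. *)
rewrite /Rintegral (@continuous_FTC2 _ _ f)//.
  exact/continuous_subspaceT/continuous_derive1_line.
split=> [t _//||].
  exact/cvg_at_right_filter/f_continuous.
exact/cvg_at_left_filter/f_continuous.
Qed.

End line_restriction.

Theorem proposition3p1 (R : realType) (Lq dh : nat)
    (F : 'M[R]_(Lq, dh) -> R) (Ovis Otxt : 'M[R]_(Lq, dh))
    (F_C1 : continuously_differentiable F) :
  let Otilde (gvis gtxt : R) := gvis *: Ovis + gtxt *: Otxt in
  let l (gvis gtxt : R) := F (Otilde gvis gtxt) in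
  let G (gvis gtxt : R) := gradient F (Otilde gvis gtxt) in
  let hatDvis := frobenius (G 1 1) Ovis in
  let hatDtxt := frobenius (G 1 1) Otxt in
  let Dvis := l 1 1 - l 0 1 in
  let Dtxt := l 1 1 - l 1 0 in
  let mu := @lebesgue_measure R in
  (* the partial derivatives of l exist *)
  (forall gvis gtxt : R,
     derivable (fun g : R => l g gtxt) gvis 1 /\
     derivable (fun g : R => l gvis g) gtxt 1) /\
  (hatDvis = partial1 l 1 1 /\ hatDtxt = partial2 l 1 1) /\
  (* the path integrals are well defined *)
  (mu.-integrable `[0, 1] (EFin \o (fun tau : R => partial1 l tau 1)) /\
   mu.-integrable `[0, 1] (EFin \o (fun tau : R => partial2 l 1 tau))) /\
  (Dvis = \int[mu]_(tau in `[0, 1]) partial1 l tau 1 /\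
   Dtxt = \int[mu]_(tau in `[0, 1]) partial2 l 1 tau).
Proof.
move=> Otilde l G hatDvis hatDtxt Dvis Dtxt mu.
(* The line lemmas expect the moving term first, so the summands are swapped for the text gate.
   Equating functions rather than values allows rewriting under [derive1]. *)
have txtE x : l x = (fun s => F (s *: Otxt + x *: Ovis)).
  by apply/funext => s; rewrite /l /Otilde addrC.
have partial1E y : partial1 l ^~ y = derive1 (fun s => F (s *: Ovis + y *: Otxt)) by [].
have partial2E x : partial2 l x = derive1 (fun s => F (s *: Otxt + x *: Ovis)).
  by rewrite -txtE.
split=> [x y|].
  split; first by have [] := is_derive_line F_C1 Ovis (y *: Otxt) x.
  by rewrite (txtE x); have [] := is_derive_line F_C1 Otxt (x *: Ovis) y.
split.
  split; first by rewrite (congr1 (@^~ 1) (partial1E 1)) (derive1_line F_C1).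
  by rewrite (congr1 (@^~ 1) (partial2E 1)) (derive1_line F_C1) /hatDtxt /G /Otilde addrC.
split.
  by rewrite partial1E partial2E; split; exact: (integrable_derive1_line F_C1).
(* The visual endpoint values agree with [Dvis] by conversion; those of the text route differ by the
   order of the summands. *)
rewrite partial1E partial2E !(Rintegral_derive1_line F_C1)//; split=> //.
by rewrite /Dtxt txtE.
Qed.
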